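(* For every integer $k\geq1$, $\delta>0$ and $\epsilon>0$ there is $N=N(k,\delta,\epsilon)$ such that for all finite nonempty sets $V,W$ and every $(k,\delta)$-stable function $f\colon V\times W\to[0,1]$ there are partitions $V=V_1\cup\ldots\cup V_m$ and $W=W_1\cup\ldots\cup W_n$ with $m,n\leq N$ such that $(V_i,W_j)$ is $(5\delta+\epsilon;\epsilon)$-homogeneous for all $(i,j)\in[m]\times[n]$ (with respect to $f$ and the normalized counting measures).
   Context: $[n]=\{1,\ldots,n\}$. $f\colon V\times W\to\mathbb{R}$ is $(k,\delta)$-stable if there are no $a_1,\ldots,a_k\in V$, $b_1,\ldots,b_k\in W$ with $|f(a_i,b_j)-f(a_j,b_i)|\geq\delta$ for all $i<j$. With $\mu(X)=|X|/|V|$ and $\nu(Y)=|Y|/|W|$, a pair $(V_*,W_* )$ with $V_*\subseteq V$, $W_*\subseteq W$ is $(\delta;\gamma)$-homogeneous if there are $V'\subseteq V_*$ with $\mu(V')\geq(1-\gamma)\mu(V_* )$, $W'\subseteq W_*$ with $\nu(W')\geq(1-\gamma)\nu(W_* )$, some $r\in[0,1]$ with $\mu(\{a\in V_*:|f(a,b)-r|\leq\delta\})\geq(1-\gamma)\mu(V_* )$ for all $b\in W'$, and some $s\in[0,1]$ with $\nu(\{b\in W_*:|f(a,b)-s|\leq\delta\})\geq(1-\gamma)\nu(W_* )$ for all $a\in V'$. *)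

(* Defs.v *)
From mathcomp Require Import all_boot all_order all_algebra.
From mathcomp Require Import reals.

Set Implicit Arguments.
Unset Strict Implicit.
Unset Printing Implicit Defensive.

Import Order.TTheory GRing.Theory Num.Theory.
Local Open Scope ring_scope.

Definition counting_measure (R : realType) (T : finType) (X : {set T}) : R :=
  #|X|%:R / #|T|%:R.

Definition stable (R : realType) (V W : finType) (k : nat) (delta : R)
    (f : V -> W -> R) : Prop :=
  ~ exists (a : 'I_k -> V) (b : 'I_k -> W),
      forall i j : 'I_k, (i < j)%N -> delta <= `|f (a i) (b j) - f (a j) (b i)|.

Definition homogeneous (R : realType) (V W : finType) (f : V -> W -> R)
    (delta gamma : R) (Vs : {set V}) (Ws : {set W}) : Prop :=
  let mu : {set V} -> R := @counting_measure R V in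
  let nu : {set W} -> R := @counting_measure R W in
  exists (V' : {set V}) (W' : {set W}),
    [/\ V' \subset Vs /\ (1 - gamma) * mu Vs <= mu V',
        W' \subset Ws /\ (1 - gamma) * nu Ws <= nu W',
        exists r : R, [/\ 0 <= r, r <= 1 &
          forall b : W, b \in W' ->
            (1 - gamma) * mu Vs <= mu [set a in Vs | `|f a b - r| <= delta]]
      & exists s : R, [/\ 0 <= s, s <= 1 &
          forall a : V, a \in V' ->
            (1 - gamma) * nu Ws <= nu [set b in Ws | `|f a b - s| <= delta]]].

(* Main.v *)
(* Round f down to F = floor (4 f / delta). Call A good if every column F(., b)
   takes almost all its values on A in a window of length 10 depending on b. If a
   set is not good, some b and some threshold split off two large subsets
   separated by a gap of 10; iterating, either one finds a good subset of
   proportional size or a binary tree of large height. The latter produces, as in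
   Hodges' bound of the branching index by the length of a ladder, rungs (a_i, b_i)
   with |F(a_i, b_j) - F(a_j, b_i)| >= 5 for i < j, contradicting stability.
   Hence V is exhausted greedily by good sets up to a remainder so small that it
   can be absorbed in the first one, and likewise for W. On a product of two
   good sets, almost every entry lies both in the window of its row and in that of
   its column, so that almost all entries of almost all columns are within
   18 units of one value, that is, within 19 delta / 4 for f. *)

Require Import Defs.
From mathcomp Require Import all_boot all_order all_algebra.
From mathcomp Require Import reals.
From mathcomp Require Import zify lra.

Import Order.TTheory GRing.Theory Num.Theory.

(** * Good sets, trees and ladders *)

Definition in_window (g i x : nat) : bool := (i <= x < i + g)%N.

Definition good {V W : finType} (F : V -> W -> nat) (g p : nat) (A : {set V}) :
    Prop :=
  forall b, exists i, p * #|[set a in A | ~~ in_window g i (F a b)]| <= #|A|.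

(* The complete binary trees of height d with inner nodes (b, i) satisfying N and
   leaves in A, where a leaf a below the node (b, i) has F a b <= i on the left
   and F a b >= i + g on the right. *)
Fixpoint tree {V W : finType} (F : V -> W -> nat) (g : nat)
    (N : W -> nat -> Prop) (d : nat) (A : {set V}) : Prop :=
  if d is d'.+1 then
    exists b i, [/\ N b i, tree F g N d' [set a in A | F a b <= i]
                         & tree F g N d' [set a in A | i + g <= F a b]]
  else A != set0.

Lemma tree_mono {V W : finType} (F : V -> W -> nat) g (N N' : W -> nat -> Prop) d
    (A A' : {set V}) :
  (forall b i, N b i -> N' b i) -> A \subset A' ->
  tree F g N d A -> tree F g N' d A'.
Proof.
move=> NN'; elim: d A A' => [|d IHd] A A' sAA' /=.
  by apply: contraNneq => A'0; rewrite A'0 subset0 in sAA'.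
have sub (P : pred V) : [set a in A | P a] \subset [set a in A' | P a].
  by apply/subsetP=> a; rewrite !inE => /andP[/(subsetP sAA')-> ->].
by move=> [b [i [/NN' Nbi tl tr]]]; exists b, i; split=> //;
   [apply: IHd tl | apply: IHd tr]; apply: sub.
Qed.

Lemma tree_nonempty {V W : finType} (F : V -> W -> nat) g N d (A : {set V}) :
  tree F g N d A -> A != set0.
Proof.
elim: d A => //= d IHd A [b [i [_ /IHd/set0Pn[a]]]].
by rewrite inE => /andP[aA _] _; apply/set0Pn; exists a.
Qed.

(** Ramsey property of trees: a root of colour [C] joins two [C]-trees found on its sides, unless
    one side already holds the whole tree of the other colour; symmetrically for the other
    colour. *)
Lemma tree_color {V W : finType} (F : V -> W -> nat) g (N : W -> nat -> Prop)
    (C : W -> nat -> bool) d e (A : {set V}) :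
  tree F g N (d + e) A ->
  tree F g (fun b i => N b i /\ C b i) d A \/
  tree F g (fun b i => N b i /\ ~~ C b i) e A.
Proof.
have [n] := ubnP (d + e); elim: n d e A => // n IHn [|d] [|e] A;
  try by move=> _ /tree_nonempty ?; by [left | right].
move=> lt_n [b [i [Nbi tl tr]]].
have sub (P : pred V) : [set a in A | P a] \subset A.
  by apply/subsetP=> a; rewrite inE => /andP[].
case Cbi: (C b i).
- have lt_n' : d + e.+1 < n by lia.
  case: (IHn d e.+1 _ lt_n' tl) => [tl'|tl']; last first.
    by right; apply: tree_mono tl'.
  case: (IHn d e.+1 _ lt_n' tr) => [tr'|tr']; last first.
    by right; apply: tree_mono tr'.
  by left; exists b, i.
- have eq_h : d.+1 + e = d + e.+1 by rewrite addSnnS.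
  have {}tl : tree F g N (d.+1 + e) [set a in A | F a b <= i] by rewrite eq_h.
  have {}tr : tree F g N (d.+1 + e) [set a in A | i + g <= F a b]
    by rewrite eq_h.
  have lt_n' : d.+1 + e < n by lia.
  case: (IHn d.+1 e _ lt_n' tl) => [tl'|tl'].
    by left; apply: tree_mono tl'.
  case: (IHn d.+1 e _ lt_n' tr) => [tr'|tr'].
    by left; apply: tree_mono tr'.
  by right; exists b, i; rewrite Cbi.
Qed.

(* Only rungs with equal thresholds are compared; the thresholds are made equal
   afterwards, by the pigeonhole principle on the ladder. *)
Definition rung_rel {V W : finType} (F : V -> W -> nat) (D : nat)
    (t u : V * W * nat) : bool :=
  (t.2 == u.2) ==> (D <= F t.1.1 u.1.2 - F u.1.1 t.1.2) ||
                   (D <= F u.1.1 t.1.2 - F t.1.1 u.1.2).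

(** Each colour in [tree_color] needs one level for the root that becomes a rung, the rest for the
    recursion. In closed form this is $2^{n+1}-2$. *)
Fixpoint ladder_height (n : nat) : nat :=
  if n is n'.+1 then (ladder_height n').+1 + (ladder_height n').+1 else 0.

(* Pick any leaf c and a subtree on whose nodes (b, i) the sign of
   F c b - (i + D) is constant. The next rung is c with the root of the subtree,
   and the search continues on the side of that root opposite to the sign. *)
Lemma tree_ladder {V W : finType} (F : V -> W -> nat) D (N : W -> nat -> Prop) n
    (A : {set V}) :
  tree F (D + D) N (ladder_height n) A ->
  exists s : seq (V * W * nat),
    [/\ size s = n, pairwise (rung_rel F D) s
      & forall c b i, (c, b, i) \in s -> c \in A /\ N b i].
Proof.
elim: n N A => [|n IHn] N A; first by exists [::].
move=> tA; have /set0Pn[c cA] := tree_nonempty _ _ _ _ _ tA.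
have [] := tree_color _ _ _ (fun b i => F c b < i + D) _ _ _ tA.
- move=> [b [i [[Nbi _] _ /IHn[s [sz_s pw_s s_in]]]]].
  exists ((c, b, i) :: s); split; first by rewrite /= sz_s.
    rewrite /= pw_s andbT; apply/allP=> -[[c' b'] i'] /s_in[].
    rewrite inE /rung_rel /= => /andP[_ hi] [_ lo].
    (* For [i' = i], [F c b' < i + D] and [i + (D + D) <= F c' b] leave a gap of at least [D]. *)
    by apply/implyP=> /eqP ii'; lia.
  move=> c' b' i'; rewrite inE => /orP[/eqP[-> -> ->] //|/s_in[]].
  by rewrite inE => /andP[? _] [].
- move=> [b [i [[Nbi _] /IHn[s [sz_s pw_s s_in]] _]]].
  exists ((c, b, i) :: s); split; first by rewrite /= sz_s.
    rewrite /= pw_s andbT; apply/allP=> -[[c' b'] i'] /s_in[].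
    rewrite inE /rung_rel /= => /andP[_ lo] [_ hi].
    by apply/implyP=> /eqP ii'; lia.
  move=> c' b' i'; rewrite inE => /orP[/eqP[-> -> ->] //|/s_in[]].
  by rewrite inE => /andP[? _] [].
Qed.

Lemma popular_label {T : eqType} (h : T -> nat) M k (s : seq T) :
  all (fun x => h x < M) s -> M * k <= size s -> 0 < M ->
  exists i, k <= count (fun x => h x == i) s.
Proof.
elim: M s => // M IHM s ltM le_s _.
have [lt_k|?] := ltnP (count (fun x => h x == M) s) k; last by exists M.
have szs := count_predC (fun x => h x == M) s.
case: M => [|M] in IHM ltM le_s lt_k szs *.
  exfalso; have : count (fun x => h x == 0) s = size s; last by lia.
  by apply/eqP; rewrite -all_count; apply: sub_all ltM => x; lia.
have [||//|i le_i] := IHM [seq x <- s | h x != M.+1].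
- by apply/allP=> x; rewrite mem_filter => /andP[nx /(allP ltM)]; lia.
- by rewrite size_filter -[X in _ <= X]/(count (predC (fun x => h x == M.+1)) s); nia.
exists i; apply: leq_trans le_i _; rewrite count_filter.
by apply: sub_count => x /= /andP[].
Qed.

Definition ladder_free {V W : finType} (F : V -> W -> nat) (D k : nat) : Prop :=
  ~ exists (a : 'I_k -> V) (b : 'I_k -> W), forall i j : 'I_k, i < j ->
      (D <= F (a i) (b j) - F (a j) (b i)) || (D <= F (a j) (b i) - F (a i) (b j)).

Lemma ladder_free_no_tree {V W : finType} (F : V -> W -> nat) D k M
    (A : {set V}) :
  ladder_free F D k ->
  ~ tree F (D + D) (fun _ i => i <= M) (ladder_height (M.+1 * k)) A.
Proof.
move=> free /tree_ladder[s [sz_s pw_s s_in]]; apply: free.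
have [||//|i le_k] := @popular_label _ (fun t : V * W * nat => t.2) M.+1 k s.
- by apply/allP=> -[[c b] j] /s_in[_]; rewrite /= ltnS.
- by rewrite sz_s.
case: k => [|k] in sz_s le_k *.
  by exists (fun x : 'I_0 => False_rect _ (notF (ltn_ord x))),
    (fun x : 'I_0 => False_rect _ (notF (ltn_ord x))) => -[].
set s' := [seq t <- s | t.2 == i].
have sz_s' : k < size s' by rewrite size_filter.
have [t0 _] : exists t0, t0 \in s' by case: (s') sz_s' => // t r _; exists t;
  rewrite inE eqxx.
exists (fun j => (nth t0 s' j).1.1), (fun j => (nth t0 s' j).1.2) => j l lt_jl.
have lt_s (x : 'I_k.+1) : x < size s' by apply: leq_trans sz_s'.
have /pairwiseP-/(_ t0 j l) : pairwise (rung_rel F D) s'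
  by apply: pairwise_filter.
rewrite !inE => /(_ (lt_s j) (lt_s l) lt_jl) /implyP; apply.
by move: (mem_nth t0 (lt_s j)) (mem_nth t0 (lt_s l));
   rewrite !mem_filter => /andP[/eqP-> _] /andP[/eqP-> _].
Qed.

(** * Extraction of good sets and the greedy partition *)

Lemma good_or_tree {V W : finType} (F : V -> W -> nat) g q M d (A : {set V}) :
  0 < q -> (forall a b, F a b <= M) -> A != set0 ->
  (exists A' : {set V}, [/\ A' \subset A, good F g q A', A' != set0
                          & #|A| <= (2 * q) ^ d * #|A'|]) \/
  tree F g (fun _ i => i <= M) d A.
Proof.
move=> q_gt0 leM; elim: d A => [|d IHd] A nzA; first by right.
pose bad b i := [set a in A | ~~ in_window g i (F a b)].
have [/forallP allgood|] :=
    boolP [forall b, exists i : 'I_M.+1, q * #|bad b i| <= #|A|].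
  left; exists A; split=> // [b|].
    by have /existsP[i] := allgood b; exists i.
  by rewrite leq_pmull // expn_gt0; lia.
rewrite negb_forall => /existsP[b]; rewrite negb_exists => /forallP badb.
pose low i := [set a in A | F a b <= i].
(* Take the least [i] for which [low i] has at least [#|A| / (2q)] elements. Strictly below [i]
   there are at most that many, yet more than [#|A| / q] lie outside the window, so [high] also gets
   at least [#|A| / (2q)]. *)
have [|i /= le_i min_i] := @ex_minnP (fun i => #|A| <= 2 * q * #|low i|).
  exists M; rewrite (_ : low M = A) ?leq_pmull ?muln_gt0 //.
  by apply/setP=> a; rewrite inE leM andbT.
have iM : i <= M.
  apply: min_i; rewrite (_ : low M = A) ?leq_pmull ?muln_gt0 //.
  by apply/setP=> a; rewrite inE leM andbT.
pose high := [set a in A | i + g <= F a b].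
have A_gt0 : 0 < #|A| by rewrite card_gt0.
have le_high : #|A| <= 2 * q * #|high|.
  have := badb (Ordinal (iM : i < M.+1)); rewrite -ltnNge /= => lt_bad.
  pose below := [set a in A | F a b < i].
  have le_below : 2 * q * #|below| <= #|A|.
    case: i => [|i] in min_i below {le_i iM high lt_bad} *.
      by rewrite (_ : below = set0) ?cards0 ?muln0 //; apply/setP=> a;
        rewrite !inE andbF.
    by apply: ltnW; rewrite ltnNge; apply/negP=> /min_i; rewrite ltnn.
  have : #|bad b i| <= #|below| + #|high|.
    rewrite -cardsUI; apply: leq_trans (leq_addr _ _); apply: subset_leq_card.
    by apply/subsetP=> a; rewrite !inE /in_window; case: (a \in A) => //=; lia.
  by nia.
have step (B : {set V}) : B \subset A -> #|A| <= 2 * q * #|B| ->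
   (exists A' : {set V}, [/\ A' \subset A, good F g q A', A' != set0
                          & #|A| <= (2 * q) ^ d.+1 * #|A'|]) \/
    tree F g (fun _ i => i <= M) d B.
  move=> sBA leB; have nzB : B != set0 by rewrite -card_gt0; lia.
  case: (IHd B nzB) => [[A' [sA' gA' nzA' leA']]|]; last by right.
  left; exists A'; split=> //; first exact: subset_trans sBA.
  by rewrite expnS -mulnA; apply: leq_trans leB _; rewrite leq_mul2l leA' orbT.
have sub (P : pred V) : [set a in A | P a] \subset A.
  by apply/subsetP=> a; rewrite inE => /andP[].
case: (step _ (sub _) le_i) => [|tl]; first by left.
case: (step _ (sub _) le_high) => [|tr]; first by left.
by right; exists b, i.
Qed.

Lemma good_partition {V W : finType} (F : V -> W -> nat) g p K :
  0 < p -> 0 < #|V| ->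
  (forall A : {set V}, A != set0 -> exists A' : {set V},
     [/\ A' \subset A, good F g (2 * p) A', A' != set0 & #|A| <= K * #|A'|]) ->
  exists P : {set {set V}},
    [/\ partition P [set: V], #|P| <= (2 * p * K * K).+1
      & forall A, A \in P -> good F g p A].
Proof.
(* If [T * #|Z| <= #|V|] and [#|V| <= K * #|A1|], then [Z] has at most [#|A1| / (2p)] elements.
   Joined to a set [A1] of tolerance [1/(2p)], it keeps the tolerance within [1/p]. *)
move=> p_gt0 V_gt0 extract; pose T := 2 * p * K.
(* [n] bounds the extractions left: if [#|V| < T * #|Z|] and [#|Z| <= K * #|A|], then
   [#|V| <= T * K * #|A|], so removing [A] lowers [n] by one. *)
have greedy n : forall Z : {set V}, T * K * #|Z| <= n * #|V| ->
    exists (P : {set {set V}}) (Z' : {set V}),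
      [/\ Z' \subset Z, partition P (Z :\: Z'), #|P| <= n, T * #|Z'| <= #|V|
        & forall A, A \in P -> good F g (2 * p) A].
  elim: n => [|n IHn] Z le_Z; have [small|large] := leqP (T * #|Z|) #|V|.
  1,3: exists set0, Z; rewrite cards0 setDv; split=> // [|A]; last
    by rewrite inE.
  1,2: by apply/and3P; rewrite /cover /trivIset /cover !big_set0 cards0 inE.
    (* For [n = 0] the bound on a large [Z] forces [K = 0], hence [T = 0], contradicting [large]. *)
    by have K0 : K = 0; [nia | rewrite /T K0 in large; lia].
  have nzZ : Z != set0 by rewrite -card_gt0; case: #|Z| large; lia.
  have [A [sAZ gA nzA leA]] := extract Z nzZ.
  have cardZ : #|Z| = #|A| + #|Z :\: A|.
    by rewrite -(cardsID A Z) (setIidPr sAZ).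
  have [|P [Z' [sZ' partP leP leZ' goodP]]] := IHn (Z :\: A).
    have : #|V| <= T * K * #|A| by nia.
    by nia.
  have disj : [disjoint A & (Z :\: A) :\: Z'].
    by rewrite -setI_eq0; apply/eqP/setP=> x; rewrite !inE; case: (x \in A);
      rewrite ?andbF.
  exists (A |: P), Z'; split=> //.
  - exact: subset_trans sZ' (subsetDl _ _).
  - rewrite (_ : Z :\: Z' = A :|: (Z :\: A :\: Z')); first exact: partitionU1.
    apply/setP=> x; rewrite !inE; case xA: (x \in A) => //=.
    rewrite (subsetP sAZ) // andbT; apply/negP=> /(subsetP sZ').
    by rewrite inE xA.
  - by rewrite cardsU1; case: (A \notin P); lia.
  - by move=> B; rewrite in_setU1 => /orP[/eqP->|/goodP].
have nzV : [set: V] != set0 by rewrite -card_gt0 cardsT.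
have [A1 [_ gA1 nzA1]] := extract _ nzV; rewrite cardsT => leA1.
have [|P [Z [sZ partP leP leZ goodP]]] := greedy (T * K) (~: A1).
  by rewrite leq_mul2l max_card orbT.
have weaken (A : {set V}) : good F g (2 * p) A -> good F g p A.
  by move=> gA b; have [i] := gA b; exists i; nia.
exists ((A1 :|: Z) |: P); split.
- rewrite (_ : [set: V] = (A1 :|: Z) :|: (~: A1 :\: Z)).
    apply: partitionU1 => //.
      by apply: contra nzA1 => /eqP/setP A0; apply/eqP/setP=> x; have := A0 x;
        rewrite !inE; case: (x \in A1).
    by rewrite -setI_eq0; apply/eqP/setP=> x; rewrite !inE; case: (x \in A1);
      case: (x \in Z).
  by apply/setP=> x; rewrite !inE; case: (x \in A1); case: (x \in Z).
- by rewrite cardsU1 -/T; case: (_ \notin P); lia.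
move=> A; rewrite in_setU1 => /orP[/eqP-> {A}|/goodP/weaken//] b.
have [i bad_i] := gA1 b; exists i.
set X := [set a in A1 :|: Z | _]; set Y := [set a in A1 | _] in bad_i.
have leX : #|X| <= #|Y| + #|Z|.
  rewrite -cardsUI; apply: leq_trans (leq_addr _ _); apply: subset_leq_card.
  by apply/subsetP=> a; rewrite !inE; case: (a \in A1); case: (a \in Z);
    rewrite /= ?orbT ?orbF.
have leU : #|A1| <= #|A1 :|: Z| by apply: subset_leq_card; apply: subsetUl.
have K_gt0 : 0 < K by nia.
have : 2 * p * #|Z| <= #|A1|.
  by rewrite -(leq_pmul2l K_gt0); apply: leq_trans leA1; rewrite /T in leZ; nia.
by nia.
Qed.

(** * Pairs of good sets *)

Lemma card_set_in {T : finType} (A : {set T}) (P : pred T) :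
  #|[set x in A | P x]| = \sum_(x in A) P x.
Proof.
by rewrite -sum1dep_card big_mkcondr; apply: eq_bigr => x _; case: (P x).
Qed.

Definition close (r x y : nat) : bool := (x <= y + r) && (y <= x + r).

(** Double counting yields a row [a0] with few entries outside the window of their row or column.
    For [b] in [B'] and most [a], [F a b] and [F a0 b] share the window of column [b], and [F a0 b]
    and [F a0 b0] that of row [a0]; each step costs at most [g.-1]. *)
Lemma good_pair {V W : finType} (F : V -> W -> nat) g p (A : {set V})
    (B : {set W}) :
  A != set0 -> B != set0 -> good F g p A -> good (fun b a => F a b) g p B ->
  exists a0 b0 (B' : {set W}),
    [/\ B' \subset B, p * #|B :\: B'| <= 2 * #|B|
      & forall b, b \in B' ->
          p * #|[set a in A | ~~ close (2 * g.-1) (F a b) (F a0 b0)]| <= #|A|].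
Proof.
move=> nzA nzB /fin_all_exists[i gA] /fin_all_exists[j gB].
pose typ a b := in_window g (i b) (F a b) && in_window g (j a) (F a b).
have [a0 a0A le_a0] : exists2 a0, a0 \in A &
    p * #|[set b in B | ~~ typ a0 b]| <= 2 * #|B|.
  apply/exists_inP; apply: contraT; rewrite negb_exists_in => /forall_inP many.
  have le_sum : #|A| * (2 * #|B|).+1 <=
      \sum_(a in A) p * #|[set b in B | ~~ typ a b]|.
    by rewrite -sum_nat_const; apply: leq_sum => a /many; rewrite -ltnNge.
  have le_typ : \sum_(a in A) p * #|[set b in B | ~~ typ a b]| <=
      \sum_(a in A) p * #|[set b in B | ~~ in_window g (j a) (F a b)]| +
      \sum_(b in B) p * #|[set a in A | ~~ in_window g (i b) (F a b)]|.
    have -> : \sum_(b in B) p * #|[set a in A | ~~ in_window g (i b) (F a b)]| =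
        \sum_(a in A) p * #|[set b in B | ~~ in_window g (i b) (F a b)]|.
      rewrite -!big_distrr /=; congr (_ * _).
      under eq_bigr do rewrite card_set_in.
      under [RHS]eq_bigr do rewrite card_set_in.
      exact: exchange_big.
    rewrite -big_split /=; apply: leq_sum => a _; rewrite -mulnDr leq_mul2l.
    apply/orP; right; rewrite -cardsUI; apply: leq_trans (leq_addr _ _).
    apply: subset_leq_card; apply/subsetP=> b; rewrite !inE negb_and.
    by case: (b \in B) => //=; rewrite orbC.
  have le_j : \sum_(a in A) p * #|[set b in B | ~~ in_window g (j a) (F a b)]|
      <= #|A| * #|B| by rewrite -sum_nat_const; apply: leq_sum => a _;
        apply: gB.
  have le_i : \sum_(b in B) p * #|[set a in A | ~~ in_window g (i b) (F a b)]|
      <= #|B| * #|A| by rewrite -sum_nat_const; apply: leq_sum => b _;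
        apply: gA.
  by move: nzA; rewrite -card_gt0; nia.
pose B' := [set b in B | typ a0 b].
have sB' : B' \subset B by apply/subsetP=> b; rewrite inE => /andP[].
have le_B' : p * #|B :\: B'| <= 2 * #|B|.
  rewrite (_ : B :\: B' = [set b in B | ~~ typ a0 b]) //.
  by apply/setP=> b; rewrite !inE; case: (b \in B); rewrite ?andbF ?andbT.
have [B'0|[b0 b0B']] := set_0Vmem B'.
  have /set0Pn[b0 _] := nzB; exists a0, b0, B'; split=> // b.
  by rewrite B'0 inE.
exists a0, b0, B'; split=> // b bB'; apply: leq_trans (gA b); rewrite leq_mul2l.
apply/orP; right; apply: subset_leq_card; apply/subsetP=> a; rewrite !inE.
move: b0B' bB'; rewrite !inE => /andP[_ typ0] /andP[_ typb].
case: (a \in A) => //=; apply: contra.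
by move: typ0 typb; rewrite /typ /in_window /close; lia.
Qed.

(** * From rounded values back to real ones *)

Local Open Scope ring_scope.

(** The floors hide a discrepancy of at most one unit [z], hence [r.+1]. *)
Lemma trunc_close (R : realType) (z x y : R) (r : nat) :
  0 < z -> 0 <= x -> 0 <= y ->
  close r (Num.trunc (x / z)) (Num.trunc (y / z)) -> `|x - y| <= r.+1%:R * z.
Proof.
move=> z_gt0 x_ge0 y_ge0.
have /truncn_itv : 0 <= x / z by rewrite divr_ge0 // ltW.
have /truncn_itv : 0 <= y / z by rewrite divr_ge0 // ltW.
set m := Num.trunc (y / z); set n := Num.trunc (x / z).
rewrite !ler_pdivlMr // !ltr_pdivrMr //.
move=> /andP[my ym] /andP[nx xn] /andP[].
rewrite -(ler_nat R) -(ler_nat R m) !natrD => nm mn.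
rewrite -!natr1 in ym xn *.
have := ler_wpM2r (ltW z_gt0) nm; have := ler_wpM2r (ltW z_gt0) mn.
by move=> ? ?; rewrite ler_norml; apply/andP; split; lra.
Qed.

Lemma trunc_far (R : realType) (z x y : R) (n : nat) :
  0 < z -> 0 <= x -> 0 <= y ->
  (n < Num.trunc (x / z) - Num.trunc (y / z))%N -> n%:R * z <= `|x - y|.
Proof.
move=> z_gt0 x_ge0 y_ge0.
have /truncn_itv : 0 <= x / z by rewrite divr_ge0 // ltW.
have /truncn_itv : 0 <= y / z by rewrite divr_ge0 // ltW.
set m := Num.trunc (y / z); set l := Num.trunc (x / z).
rewrite !ler_pdivlMr // !ltr_pdivrMr //.
move=> /andP[my ym] /andP[lx xl];
  rewrite ltn_subRL -addnS -(ler_nat R) natrD => h.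
rewrite -!natr1 in ym h *.
have := ler_wpM2r (ltW z_gt0) h => ?.
by apply: le_trans (ler_norm _); lra.
Qed.

Lemma counting_measure_ge (R : realType) (T : finType) (p : nat) (eps : R)
    (A X : {set T}) :
  (0 < p)%N -> 2 <= eps * p%:R -> X \subset A ->
  (p * #|A :\: X| <= 2 * #|A|)%N ->
  (1 - eps) * counting_measure R A <= counting_measure R X.
Proof.
move=> p_gt0 le_eps sXA le_p; rewrite /counting_measure mulrA.
rewrite ler_wpM2r ?invr_ge0 ?ler0n //.
have -> : #|A| = (#|X| + #|A :\: X|)%N by rewrite -(cardsID X A) (setIidPr sXA).
rewrite -(ler_nat R) !natrM in le_p.
have p_gt0' : 0 < p%:R :> R by rewrite ltr0n.
rewrite mulrBl mul1r -lerBrDr natrD.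
suff : #|A :\: X|%:R <= eps * #|A|%:R.
  by rewrite -(cardsID X A) (setIidPr sXA) natrD; lra.
rewrite -(ler_pM2l p_gt0'); apply: le_trans le_p _.
by rewrite mulrCA mulrA ler_wpM2r // mulrC.
Qed.

(** One half of homogeneity; the other follows by exchanging [V] and [W]. The constant is
    [19 = 2 * (10 - 1) + 1]: two windows of length [10] and one unit for rounding. *)
Lemma good_pair_homogeneous (R : realType) (V W : finType) (f : V -> W -> R)
    (z eps rho : R) (p : nat) (A : {set V}) (B : {set W}) :
  let F a b := Num.trunc (f a b / z) in
  (forall a b, 0 <= f a b <= 1) -> 0 < z -> 19 * z <= rho ->
  (0 < p)%N -> 2 <= eps * p%:R ->
  A != set0 -> B != set0 ->
  good F 10 p A -> good (fun b a => F a b) 10 p B ->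
  exists B' : {set W}, [/\ B' \subset B,
    (1 - eps) * counting_measure R B <= counting_measure R B'
  & exists r : R, [/\ 0 <= r, r <= 1 & forall b, b \in B' ->
      (1 - eps) * counting_measure R A <=
      counting_measure R [set a in A | `|f a b - r| <= rho]]].
Proof.
move=> F f01 z_gt0 le_rho p_gt0 le_eps nzA nzB gA gB.
have [a0 [b0 [B' [sB' le_B' homB']]]] := good_pair _ _ _ _ _ nzA nzB gA gB.
exists B'; split=> //; first exact: counting_measure_ge le_B'.
have f_ge0 a b : 0 <= f a b by case/andP: (f01 a b).
exists (f a0 b0); split=> //; first by case/andP: (f01 a0 b0).
move=> b /homB' le_b; apply: (@counting_measure_ge R V p) => //.
  by apply/subsetP=> a; rewrite inE => /andP[].
apply: leq_trans (leq_trans le_b _); last by rewrite leq_pmull.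
rewrite leq_mul2l; apply/orP; right; apply: subset_leq_card.
apply/subsetP=> a; rewrite !inE; case: (a \in A); rewrite ?andbF ?andbT //=.
by apply: contra => /(@trunc_close R z _ _ _ z_gt0 (f_ge0 a b) (f_ge0 a0 b0)) h;
  apply: le_trans h le_rho.
Qed.

(** * Partitions for stable functions *)

Lemma stable_good_partition (R : realType) (V W : finType) (f : V -> W -> R)
    (k p : nat) (delta : R) :
  let z := delta / 4 in let F a b := Num.trunc (f a b / z) in
  let K := ((2 * (2 * p)) ^ ladder_height ((Num.trunc z^-1).+1 * k))%N in
  0 < delta -> (0 < p)%N -> (0 < #|V|)%N -> (forall a b, 0 <= f a b <= 1) ->
  stable k delta f ->
  exists P : {set {set V}},
    [/\ partition P [set: V], (#|P| <= (2 * p * K * K).+1)%N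
      & forall A, A \in P -> good F 10 p A].
Proof.
move=> z F K delta_gt0 p_gt0 V_gt0 f01 st.
have z_gt0 : 0 < z by rewrite divr_gt0.
have f_ge0 a b : 0 <= f a b by case/andP: (f01 a b).
have far : 4%:R * z = delta by rewrite /z; lra.
apply: good_partition => // A nzA.
(* Since [f <= 1], the thresholds are bounded in terms of [delta] alone, which makes [K] independent
   of [V], [W] and [f]. *)
have leM a b : (F a b <= Num.trunc z^-1)%N.
  apply: le_truncn; case/andP: (f01 a b) => _ f1.
  by rewrite -[leRHS]mul1r ler_wpM2r // invr_ge0 ltW.
case: (good_or_tree F 10 (2 * p) _ (ladder_height ((Num.trunc z^-1).+1 * k)) A
         _ leM nzA) => [|//|tA]; first by rewrite muln_gt0.
(* The window length [10] is [5 + 5], and a rounded gap of [5] means at least [4 * z = delta] for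
   [f]. *)
exfalso; apply: (ladder_free_no_tree F 5 k) tA => -[a [b ladder]].
apply: st; exists a, b => i j /ladder /orP[] h; rewrite -far.
  exact: trunc_far z_gt0 (f_ge0 _ _) (f_ge0 _ _) h.
rewrite distrC; exact: trunc_far z_gt0 (f_ge0 _ _) (f_ge0 _ _) h.
Qed.

Theorem theorem5p2 (R : realType) (k : nat) (delta eps : R) :
  (1 <= k)%N -> 0 < delta -> 0 < eps ->
  exists N : nat,
    forall (V W : finType) (f : V -> W -> R),
      (0 < #|V|)%N -> (0 < #|W|)%N ->
      (forall a b, 0 <= f a b <= 1) ->
      stable k delta f ->
      exists (P : {set {set V}}) (Q : {set {set W}}),
        [/\ partition P [set: V], partition Q [set: W],
            (#|P| <= N)%N, (#|Q| <= N)%N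
          & forall (Vi : {set V}) (Wj : {set W}), Vi \in P -> Wj \in Q ->
              homogeneous f (5 * delta + eps) eps Vi Wj].
Proof.
(* [p] exceeds [2 / eps], so that exceptional shares up to [2 / p] stay below [eps]. *)
move=> _ delta_gt0 eps_gt0; pose p := (Num.trunc (2 / eps)).+1.
pose K :=
  ((2 * (2 * p)) ^ ladder_height ((Num.trunc (delta / 4)^-1).+1 * k))%N.
exists (2 * p * K * K).+1 => V W f V_gt0 W_gt0 f01 st.
have [P [partP leP goodP]] :=
  stable_good_partition R V W f k p delta delta_gt0 isT V_gt0 f01 st.
have stT : stable k delta (fun b a => f a b).
  move=> [b [a ladder]]; apply: st; exists a, b => i j /ladder.
  by rewrite distrC.
have [Q [partQ leQ goodQ]] := stable_good_partition R W V (fun b a => f a b)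
  k p delta delta_gt0 isT W_gt0 (fun b a => f01 a b) stT.
exists P, Q; split=> // A B AP BQ.
have nzA : A != set0 by case/and3P: partP => _ _; apply: contraNneq => <-.
have nzB : B != set0 by case/and3P: partQ => _ _; apply: contraNneq => <-.
have le_eps : 2 <= eps * p%:R.
  rewrite mulrC -ler_pdivrMr // ltW //.
  by case/andP: (truncn_itv (divr_ge0 (ler0n _ 2) (ltW eps_gt0))).
have z_gt0 : 0 < delta / 4 by rewrite divr_gt0.
have le_rho : 19 * (delta / 4) <= 5 * delta + eps by lra.
have [B' [sB' geB' homB']] := good_pair_homogeneous R V W f _ eps _ p A B
  f01 z_gt0 le_rho isT le_eps nzA nzB (goodP A AP) (goodQ B BQ).
have [A' [sA' geA' homA']] := good_pair_homogeneous R W V (fun b a => f a b) _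
  eps _ p B A (fun b a => f01 a b) z_gt0 le_rho isT le_eps nzB nzA
  (goodQ B BQ) (goodP A AP).
by exists A', B'.
Qed.
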